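(* Let $H$ be a real Hilbert space, $C\subset H$ a nonempty closed convex set, $S:H\to H$ a map, and $P_C$ the nearest point projection of $H$ onto $C$. Let $\gamma>0$ and assume that $P_C\circ(I-\gamma S)$ is an enriched interpolative Kannan type operator. Then the variational inequality problem $VIP(S,C)$ has a unique solution $x^*$, and there exists $\lambda\in(0,1]$ such that for any $x_0\in C$ the sequence $\{x_n\}_{n=0}^\infty$ defined by $$x_{n+1}=(1-\lambda)x_n+\lambda P_C(I-\gamma S)x_n,\quad n\ge 0,$$ converges strongly to $x^*$.
   Context: A map $T:X\to X$ on a normed space $(X,\|\cdot\|)$ is called an enriched interpolative Kannan type operator if there exist $b\in[0,\infty)$, $a\in[0,1)$ and $\alpha\in(0,1)$ such that for all $x,y\in X$ $$\|b(x-y)+(Tx-Ty)\|\le a\,\|x-Tx\|^{\alpha}\,\|y-Ty\|^{1-\alpha}.$$ Here this is applied with $X=H$ and $T=P_C\circ(I-\gamma S)$, where $I$ is the identity map of $H$. The variational inequality problem $VIP(S,C)$ is to find $x^*\in C$ such that $\langle Sx^*,x-x^*\rangle\ge 0$ for all $x\in C$. *)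

(* Defs.v *)
From mathcomp Require Export all_boot all_order all_algebra sesquilinear.
From mathcomp Require Export all_classical all_reals all_analysis.
Export Order.TTheory GRing.Theory Num.Theory.
Export numFieldNormedType.Exports.

Set Implicit Arguments.
Unset Strict Implicit.
Unset Printing Implicit Defensive.

Local Open Scope classical_set_scope.
Local Open Scope ring_scope.

(* A real Hilbert space is given as a complete normed space [H] together with
   a positive definite symmetric bilinear form [dot] inducing its norm. *)
Definition induces_norm (R : realType) (H : normedModType R)
    (dot : {dot H for idfun}) : Prop :=
  forall x : H, `|x| = Num.sqrt (dot x x).

Definition nearest_points (R : realType) (H : normedModType R)
    (C : set H) (x : H) : set H :=
  [set p | C p /\ forall y, C y -> `|x - p| <= `|x - y|].

(* The default value 0 is only taken when [x] has no nearest point in [C];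
   this never happens for [C] nonempty, closed and convex in a Hilbert space,
   where moreover the nearest point is unique. *)
Definition nearest_point_projection (R : realType) (H : normedModType R)
    (C : set H) (x : H) : H :=
  xget 0 (nearest_points C x).

Definition enriched_interpolative_Kannan (R : realType) (X : normedModType R)
    (T : X -> X) : Prop :=
  exists b a alpha : R,
    [/\ 0 <= b, 0 <= a < 1, 0 < alpha < 1 &
      forall x y : X,
        `|b *: (x - y) + (T x - T y)| <=
          a * `|x - T x| `^ alpha * `|y - T y| `^ (1 - alpha)].

Definition VIP (R : realType) (H : normedModType R) (dot : {dot H for idfun})
    (S : H -> H) (C : set H) (z : H) : Prop :=
  C z /\ forall x, C x -> 0 <= dot (S z) (x - z).

(* Main.v *)
(* With [lambda = (1 + b)^-1], the averaged map [U = (1 - lambda) I + lambda T]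
   satisfies the interpolative Kannan inequality with [b = 0], hence
   [|U x - U y| <= a * max |x - U x| |y - U y|]; the Picard iterates of such a
   map are Cauchy and converge to a fixed point.  Since the inequality is assumed
   for all pairs, also when one of the points is fixed, the existence of a fixed
   point forces [U] to be constant, so that the iteration reaches the limit after
   one step.  The fixed points of [U] are those of [T = P_C (I - gamma S)], which
   solve the variational inequality by the obtuse angle characterisation of the
   metric projection. *)
Require Import Defs.
From mathcomp Require Import ring lra.

Set Implicit Arguments.
Unset Strict Implicit.
Unset Printing Implicit Defensive.

Local Open Scope classical_set_scope.
Local Open Scope ring_scope.

(** * A Cauchy criterion in complete spaces *)

Section Cauchy.
Variables (R : realType) (E : completeNormedModType R).

(** A single tail bound serves both the Picard iterates and the minimising sequences of the
    projection. *)
Lemma cvgn_of_dist_bound (u : nat -> E) (v : nat -> R) :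
  v n @[n --> \oo] --> 0 ->
  (forall N n m, (N <= n)%N -> (N <= m)%N -> `|u n - u m| <= v N) ->
  cvgn u.
Proof.
move=> v0 uv; apply/cauchy_cvgP/cauchy_exP => e e0.
move/cvgrPdist_lt: v0 => /(_ _ e0) [N _ vN].
exists (u N); exists N => // n /= Nn.
rewrite -ball_normE /=; apply: le_lt_trans (uv N N n (leqnn N) Nn) _.
have := vN N (leqnn N); rewrite /= sub0r normrN.
by apply: le_lt_trans; apply: ler_norm.
Qed.

End Cauchy.

(** * Fixed points of Kannan type maps *)

Section FixedPoint.
Variables (R : realType) (E : completeNormedModType R) (U : E -> E) (a : R).
Hypotheses (a_ge0 : 0 <= a) (a_lt1 : a < 1).

Section Max.
Hypothesis U_max : forall x y,
  `|U x - U y| <= a * Num.max `|x - U x| `|y - U y|.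

Let u x0 n := iter n U x0.

(** For consecutive steps [c] and [d], either the maximum is [c] and [d <= a * c], or it is [d] and
    [d <= a * d] forces [d = 0]. *)
Lemma iter_step_geometric x0 n : `|u x0 n - u x0 n.+1| <= a ^+ n * `|x0 - U x0|.
Proof.
elim: n => [|n IHn]; first by rewrite expr0 mul1r.
rewrite exprS -mulrA.
have := U_max (u x0 n) (u x0 n.+1); rewrite -[U _]/(u x0 n.+1) -[U _]/(u x0 n.+2).
set d := `|u x0 n.+1 - _|; set c := `|u x0 n - _| in IHn *.
have d0 : 0 <= d by exact: normr_ge0.
have c0 : 0 <= a * c by rewrite mulr_ge0 // normr_ge0.
move=> h; apply: le_trans (ler_wpM2l a_ge0 IHn).
case: (leP c d) h => // _; have [<-//|d_neq0] := eqVneq 0 d.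
by rewrite ler_pMl ?lt_def 1?eq_sym ?d_neq0 // leNgt a_lt1.
Qed.

Lemma max_contraction_fixed_point : exists p, U p = p.
Proof.
pose v n := a ^+ n * `|(0 : E) - U 0|.
have v0 : v n @[n --> \oo] --> 0.
  rewrite -[X in _ --> X](mul0r `|(0 : E) - U 0|); apply: cvgM; last exact: cvg_cst.
  by apply: cvg_expr; rewrite ger0_norm.
have vM N n : (N <= n)%N -> `|u 0 n - u 0 n.+1| <= v N.
  move=> Nn; apply: le_trans (iter_step_geometric 0 n) _.
  by apply: ler_wpM2r => //; rewrite ler_wiXn2l // ltW.
have v_ge0 n : 0 <= v n by rewrite mulr_ge0 ?exprn_ge0.
(* The distance between two images is bounded by the larger of two steps, so no geometric series has
   to be summed. *)
have : cvgn (fun n => u 0 n.+1).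
  apply: (cvgn_of_dist_bound v0) => N n m Nn Nm.
  apply: le_trans (U_max (u 0 n) (u 0 m)) _.
  apply: (@le_trans _ _ (a * v N)).
    by apply: ler_wpM2l => //; rewrite ge_max !vM.
  by rewrite ler_piMl // ltW.
set p := lim _ => up; exists p.
have [->//|pUp] := eqVneq (U p) p; exfalso.
set e := `|p - U p|; have e0 : 0 < e by rewrite normr_gt0 subr_eq0 eq_sym.
have r0 : 0 < (1 - a) * e by rewrite mulr_gt0 // subr_gt0.
move/cvgrPdist_lt: up => /(_ _ r0) [N1 _ up].
move/cvgrPdist_lt: v0 => /(_ _ e0) [N2 _ ve].
pose n := maxn N1 N2.
have /= pn := up n (leq_maxl _ _); have /= vn := ve n (leq_maxr _ _).
have dn : `|u 0 n - u 0 n.+1| <= e.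
  apply: le_trans (vM n n (leqnn n)) (ltW _).
  by rewrite sub0r normrN ger0_norm in vn.
have := U_max (u 0 n) p; rewrite -[U (u 0 n)]/(u 0 n.+1) (max_r dn) => h.
have := ler_distD (u 0 n.+1) p (U p); rewrite -/e; lra.
Qed.

End Max.

Lemma interpolative_Kannan_constant (alpha : R) :
  0 < alpha < 1 ->
  (forall x y, `|U x - U y| <=
     a * `|x - U x| `^ alpha * `|y - U y| `^ (1 - alpha)) ->
  exists p, forall x, U x = p.
Proof.
move=> /andP[al0 al1] UK.
have [x y|p Up] := max_contraction_fixed_point.
  (* A weighted geometric mean is at most the maximum. *)
  apply: le_trans (UK x y) _; rewrite -mulrA ler_wpM2l //.
  set c := Num.max _ _.
  have c0 : 0 <= c by rewrite le_max normr_ge0.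
  have powc r : 0 < r -> forall z : R, 0 <= z -> z <= c -> z `^ r <= c `^ r.
    by move=> r0 z z0 zc; apply: ge0_ler_powR; rewrite ?nnegrE // ltW.
  have -> : c = c `^ alpha * c `^ (1 - alpha).
    by rewrite -powRD subrKC ?oner_eq0 // powRr1.
  by apply: ler_pM; rewrite ?powR_ge0 ?powc ?subr_gt0 // le_max lexx ?orbT.
exists p => x; apply/eqP; rewrite eq_sym -subr_eq0 -normr_le0 -{1}Up.
apply: le_trans (UK p x) _.
by rewrite Up subrr normr0 powR0 ?gt_eqF // mulr0 mul0r.
Qed.

End FixedPoint.

(** * Metric projection and variational inequalities *)

Section Projection.
Variables (R : realType) (H : completeNormedModType R) (dot : {dot H for idfun}).
Hypothesis hdot : induces_norm dot.

Lemma dotC x y : dot x y = dot y x.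
Proof. by rewrite hermC /= expr0 mul1r. Qed.

Lemma dotE x : dot x x = `|x| ^+ 2.
Proof.
rewrite hdot sqr_sqrtr //; have [->|x0] := eqVneq x 0; first by rewrite linear0l.
by rewrite ltW // neq0_dnorm_gt0.
Qed.

Lemma sqr_normBZ x y t :
  `|x - t *: y| ^+ 2 = `|x| ^+ 2 - 2 * t * dot x y + t ^+ 2 * `|y| ^+ 2.
Proof.
rewrite -!dotE linearBl !linearBr /= linearZl_LR !linearZr_LR /= linearZl_LR /=.
rewrite (dotC y x); ring.
Qed.

Variables (C : set H).
Hypotheses (C0 : C !=set0) (Ccl : closed C) (Ccv : convex_set C).

Lemma convex_segment x y t : 0 <= t <= 1 -> C x -> C y -> C (x + t *: (y - x)).
Proof.
move=> /andP[t0 t1] Cx Cy.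
have := Ccv (Itv01 t0 t1) (mem_set Cy) (mem_set Cx); rewrite inE.
suff -> : x + t *: (y - x) = t *: y + (1 - t) *: x by [].
by rewrite scalerBr scalerBl scale1r addrCA addrC -addrA (addrC (- _)).
Qed.

Lemma nearest_points_dot x p :
  nearest_points C x p <-> C p /\ forall y, C y -> dot (x - p) (y - p) <= 0.
Proof.
have split_dist y t : x - (p + t *: (y - p)) = (x - p) - t *: (y - p).
  by rewrite opprD addrA.
split=> -[Cp pC]; split=> // y Cy.
  set c := dot _ _; rewrite leNgt; apply/negP => c0.
  set q := `|y - p| ^+ 2; have q0 : 0 <= q by rewrite exprn_ge0.
  (* Moving from [p] towards [y] by [t] changes the squared distance to [x] by
     [t * (t * q - 2 * c)]. This choice gives [t * q < c] and [t <= 1], so the distance would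
     drop. *)
  pose t := c / (c + q); have cq0 : 0 < c + q by rewrite ltr_wpDr.
  have t0 : 0 < t by rewrite divr_gt0.
  have tcq : t * (c + q) = c by rewrite divfK // gt_eqF.
  have t1 : t <= 1 by rewrite ler_pdivrMr // mul1r lerDl.
  have := pC (p + t *: (y - p)); rewrite split_dist.
  move=> /(_ (convex_segment _ Cp Cy)); rewrite (ltW t0) t1 => /(_ isT).
  rewrite -(ler_pXn2r (n := 2)) ?nnegrE //.
  rewrite sqr_normBZ -/c -/q; nra.
rewrite -(ler_pXn2r (n := 2)) ?nnegrE //.
have := split_dist y 1; rewrite scale1r subrKC => ->.
rewrite -(scale1r (y - p)) sqr_normBZ; have := pC y Cy.
have := sqr_ge0 `|y - p|; lra.
Qed.

(** The obtuse angle inequalities at [p] and [q] add up to [dot (q - p) (q - p) <= 0]. *)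
Lemma nearest_points_unique x p q :
  nearest_points C x p -> nearest_points C x q -> p = q.
Proof.
move=> /nearest_points_dot[Cp pC] /nearest_points_dot[Cq qC].
apply/eqP; rewrite eq_sym -subr_eq0 -normr_le0.
rewrite -(ler_pXn2r (n := 2)) ?nnegrE // expr0n /= -dotE.
have := pC q Cq; have := qC p Cp.
rewrite -(opprB q p) linearNr -linearNl opprB => h1 h2.
rewrite -[X in dot X _](subrKA x) -(addrC (x - p)) linearDl; lra.
Qed.

(** A minimising sequence is Cauchy by the parallelogram law, since midpoints stay in [C]; its limit
    lies in the closed set [C]. *)
Lemma nearest_points_nonempty x : nearest_points C x !=set0.
Proof.
pose D := inf [set `|x - y| ^+ 2 | y in C].
have hasD : has_inf [set `|x - y| ^+ 2 | y in C].
  case: C0 => c Cc; split; first by exists (`|x - c| ^+ 2), c.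
  by exists 0 => _ [y _ <-]; rewrite exprn_ge0.
have D_le y : C y -> D <= `|x - y| ^+ 2.
  by move=> Cy; apply: ge_inf; [exact: hasD.2 | exists y].
have /choice[y yC] : forall n, exists y,
    C y /\ `|x - y| ^+ 2 < D + harmonic n ^+ 2.
  move=> n; have h0 : 0 < (harmonic n : R) ^+ 2 by rewrite exprn_gt0 // invr_gt0.
  by have [_ [y Cy <-] yD] := inf_adherent h0 hasD; exists y.
have y_dist N n : (N <= n)%N -> `|x - y n| ^+ 2 <= D + harmonic N ^+ 2.
  move=> Nn; apply: le_trans (ltW (yC n).2) _; rewrite lerD2l.
  by rewrite ler_pXn2r ?nnegrE // ?invr_ge0 // /harmonic /= lef_pV2 ?posrE // ler_nat.
have cvg2h : 2 * (harmonic n : R) @[n --> \oo] --> 0.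
  rewrite -(mulr0 2); by apply: cvgM; [exact: cvg_cst | exact: cvg_harmonic].
have : cvgn y.
  apply: (cvgn_of_dist_bound cvg2h) => N n m Nn Nm.
  rewrite -(ler_pXn2r (n := 2)) ?nnegrE ?mulr_ge0 ?invr_ge0 //.
  have half01 : 0 <= (2^-1 : R) <= 1 by lra.
  have := D_le _ (convex_segment half01 (yC n).1 (yC m).1).
  rewrite opprD addrA.
  (* Eliminating the inner product between the expansions for [2^-1] and [1] yields the
     parallelogram law. *)
  have := sqr_normBZ (x - y n) (y m - y n) 2^-1.
  have := sqr_normBZ (x - y n) (y m - y n) 1.
  rewrite scale1r -[x - y n - _]addrA -!opprD subrKC (distrC (y n)).
  have := y_dist _ _ Nn; have := y_dist _ _ Nm.
  by rewrite exprMn; lra.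
set p := lim _ => yp; exists p.
have Cp : C p.
  by apply: (closed_cvg C Ccl _ _ yp); apply: nearW => n; exact: (yC n).1.
split=> // z Cz; apply/ler_addgt0Pr => e e0.
move/cvgrPdist_lt: yp => /(_ _ (divr_gt0 e0 (ltr0Sn _ 1))) [N1 _ yp].
move/cvgrPdist_lt: cvg2h => /(_ _ e0) [N2 _ he].
pose n := maxn N1 N2.
have /= pn := yp n (leq_maxl _ _); have /= hn := he n (leq_maxr _ _).
have h0 : 0 <= (harmonic n : R) by rewrite invr_ge0.
have {}hn : 2 * harmonic n < e.
  by move: hn; rewrite sub0r normrN ger0_norm // mulr_ge0.
have xyn : `|x - y n| <= `|x - z| + harmonic n.
  rewrite -(ler_pXn2r (n := 2)) ?nnegrE // ?addr_ge0 //.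
  apply: le_trans (ltW (yC n).2) _; rewrite sqrrD.
  have := D_le z Cz; have := mulr_ge0 (normr_ge0 (x - z)) h0; lra.
have := ler_distD (y n) x p; rewrite (distrC (y n) p); lra.
Qed.

Lemma nearest_point_projectionE x p :
  nearest_point_projection C x = p <-> nearest_points C x p.
Proof.
have xP : nearest_points C x (nearest_point_projection C x).
  by have [q xq] := nearest_points_nonempty x; apply: xgetPex; exists q.
by split=> [<-//|xp]; apply: nearest_points_unique xP xp.
Qed.

(** At the point [z], the obtuse angle criterion for projecting [z - gamma *: S z] is the
    variational inequality multiplied by [- gamma]. *)
Lemma VIP_fixed_point (S : H -> H) (gamma : R) z : 0 < gamma ->
  VIP dot S C z <-> nearest_point_projection C (z - gamma *: S z) = z.
Proof.
move=> gamma0; rewrite nearest_point_projectionE nearest_points_dot.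
have eq_le x :
    (dot (z - gamma *: S z - z) (x - z) <= 0) = (0 <= dot (S z) (x - z)).
  by rewrite addrAC subrr add0r linearNl linearZl_LR oppr_le0 pmulr_rge0.
by split=> -[Cz zC]; split=> // x Cx; move: (zC x Cx); rewrite eq_le.
Qed.

End Projection.

Theorem theorem4p0p1 (R : realType) (H : completeNormedModType R)
    (dot : {dot H for idfun}) (hdot : induces_norm dot)
    (C : set H) (C0 : C !=set0) (Ccl : closed C) (Ccv : convex_set C)
    (S : H -> H) (gamma : R) (gamma_gt0 : 0 < gamma)
    (hT : enriched_interpolative_Kannan
            (fun x : H => nearest_point_projection C (x - gamma *: S x))) :
  exists xstar : H,
    unique (VIP dot S C) xstar /\
    exists lambda : R, 0 < lambda <= 1 /\
      forall x : nat -> H,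
        C (x 0%N) ->
        (forall n : nat, x n.+1 =
          (1 - lambda) *: x n +
          lambda *: nearest_point_projection C (x n - gamma *: S (x n))) ->
        x n @[n --> \oo] --> xstar.
Proof.
case: hT => b [a [alpha [b0 /andP[a0 a1] alpha01 TK]]].
pose T x := nearest_point_projection C (x - gamma *: S x).
have b1 : 0 < 1 + b by rewrite ltr_wpDr.
pose lam := (1 + b)^-1; have lam0 : 0 < lam by rewrite invr_gt0.
have lam1 : lam <= 1 by rewrite invf_le1 // lerDl.
have lamb : lam * b = 1 - lam.
  by rewrite -[X in X - _](mulVf (lt0r_neq0 b1)) -/lam mulrDr mulr1 addrC addKr.
have [p Up] : exists p, forall x, (1 - lam) *: x + lam *: T x = p.
  apply: (interpolative_Kannan_constant a0 a1 alpha01) => x y.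
  have resid z : z - ((1 - lam) *: z + lam *: T z) = lam *: (z - T z).
    by rewrite scalerBl scale1r scalerBr -addrA opprD addrA subrr add0r opprD opprK.
  rewrite !resid !normrZ !(gtr0_norm lam0).
  have -> : (1 - lam) *: x + lam *: T x - ((1 - lam) *: y + lam *: T y) =
      lam *: (b *: (x - y) + (T x - T y)).
    by rewrite scalerDr scalerA lamb !scalerBr opprD addrACA.
  rewrite normrZ gtr0_norm // !powRM ?(ltW lam0) //.
  (* The residuals of the averaged map are [lam] times those of [T]; as the exponents sum to 1,
     their powers contribute exactly the factor [lam] found on the left. *)
  have lamE : lam = lam `^ alpha * lam `^ (1 - alpha).
    by rewrite -powRD subrKC ?oner_eq0 // powRr1 // ltW.
  apply: le_trans (ler_wpM2l (ltW lam0) (TK x y)) _.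
  by rewrite {1}lamE -/(T x) -/(T y); lra.
have Tfix z : T z = z <-> z = p.
  split=> [Tz|->].
    by rewrite -(Up z) Tz -scalerDl subrK scale1r.
  apply: (scalerI (lt0r_neq0 lam0)); apply: (addrI ((1 - lam) *: p)).
  by rewrite Up -scalerDl subrK scale1r.
exists p; split.
  split=> [|z].
    by apply/(VIP_fixed_point hdot C0 Ccl Ccv S p gamma_gt0)/Tfix.
  by move/(VIP_fixed_point hdot C0 Ccl Ccv S z gamma_gt0)/Tfix.
exists lam; split=> [|x _ xE]; first by rewrite lam0 lam1.
(* The sequence equals [p] only from index 1 on, hence the shift. *)
rewrite -cvg_shiftS; apply: cvg_near_cst; apply: nearW => n.
by rewrite /= xE -/(T _) Up.
Qed.
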